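(* Let $k$ be a field and let $\mathsf{E}$ be a left strictly locally finite $k$-linear category. Then the contramodule forgetful functor $\Theta_\mathsf{E}$ from the category of left $\mathcal{C}_\mathsf{E}$-contramodules to the category of left $\mathsf{E}$-modules is fully faithful.
   Context: A small $k$-linear category $\mathsf{E}$ has $k$-vector spaces $\operatorname{Hom}_\mathsf{E}(x,y)$, $k$-bilinear associative composition and identities; it is assumed that $\mathrm{id}_x\neq0$ for every object $x$. A left $\mathsf{E}$-module is a $k$-linear functor $\mathsf{E}\to k\text{-Vect}$ (spaces $P(x)$ and action maps $\operatorname{Hom}_\mathsf{E}(x,y)\otimes_kP(x)\to P(y)$); morphisms are natural transformations. Write $x\preceq y$ if there are $n\ge1$ and objects $x=z_0,\dots,z_n=y$ with $\operatorname{Hom}_\mathsf{E}(z_{i-1},z_i)\neq0$ for all $i$; $x\prec y$ means $x\preceq y$ and not $y\preceq x$. $\mathsf{E}$ is locally finite if all $\operatorname{Hom}_\mathsf{E}(x,y)$ are finite-dimensional and all sets $\{z:x\preceq z\preceq y\}$ are finite. $\mathsf{E}$ is left strictly locally finite if it is locally finite and for every object $y$ there is a finite set of objects $X_y$, with $x\prec y$ for all $x\in X_y$, such that every $f:z\to y$ with $z\prec y$ equals $\sum_{i=1}^n h_ig_i$ ($n\ge0$) for some $g_i:z\to x_i$, $h_i:x_i\to y$, $x_i\in X_y$. $\mathcal{C}_\mathsf{E}=\bigoplus_{x,y}\mathcal{C}^{x,y}$, $\mathcal{C}^{x,y}=\operatorname{Hom}_\mathsf{E}(x,y)^*$, with counit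 zero on $\mathcal{C}^{x,y}$ for $x\neq y$ and evaluation at $\mathrm{id}_x$ on $\mathcal{C}^{x,x}$, and comultiplication $\mathcal{C}^{x,y}\to\bigoplus_z\mathcal{C}^{x,z}\otimes\mathcal{C}^{z,y}$ with components dual to composition $\operatorname{Hom}_\mathsf{E}(x,z)\otimes\operatorname{Hom}_\mathsf{E}(z,y)\to\operatorname{Hom}_\mathsf{E}(x,y)$, $g\otimes h\mapsto hg$. A left contramodule over a coalgebra $(\mathcal{C},\mu,\epsilon)$ is a space $\mathfrak{P}$ with $\pi:\operatorname{Hom}_k(\mathcal{C},\mathfrak{P})\to\mathfrak{P}$ such that $\pi(c\mapsto\epsilon(c)p)=p$ and, under $\operatorname{Hom}_k(\mathcal{C},\operatorname{Hom}_k(\mathcal{C},\mathfrak{P}))\cong\operatorname{Hom}_k(\mathcal{C}\otimes\mathcal{C},\mathfrak{P})$, $f\mapsto(c'\otimes c''\mapsto f(c'')(c'))$, one has $\pi(c\mapsto\pi(f(c)))=\pi(f\circ\mu)$; morphisms commute with $\pi$. For $\varphi\in\mathcal{C}^*$ set $\varphi\cdot p=\pi(c\mapsto\varphi(c)p)$. $\Theta_\mathsf{E}$: with $e_x\in\mathcal{C}_\mathsf{E}^*$ evaluation at $\mathrm{id}_x$ on $\mathcal{C}^{x,x}$ (zero elsewhere) and, for $f\in\operatorname{Hom}_\mathsf{E}(x,y)$, $\mathrm{ev}_f$ evaluation at $f$ on $\mathcal{C}^{x,y}$ (zero elsewhere), $\Theta_\mathsf{E}(\mathfrak{P})(x)=e_x\cdot\mathfrak{P}$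 (with $\mathfrak{P}\cong\prod_xe_x\cdot\mathfrak{P}$), $f$ acting by $p\mapsto\mathrm{ev}_f\cdot p$; on morphisms it takes restrictions. *)

(* Defs.v *)
From Stdlib Require Import Relations.
From mathcomp Require Import all_boot all_order all_algebra.
From mathcomp Require Import boolp classical_sets cardinality fsbigop.

Set Implicit Arguments.
Unset Strict Implicit.
Unset Printing Implicit Defensive.
Import GRing.Theory.
Local Open Scope ring_scope.
Local Open Scope classical_set_scope.

Record klcat (k : fieldType) := KLCat {
  Ob : choiceType;
  Hm : Ob -> Ob -> vectType k;
  comp : forall x y z : Ob, Hm y z -> Hm x y -> Hm x z;
  idm : forall x : Ob, Hm x x;
  comp_linl : forall (x y z : Ob) (g : Hm x y) (a : k) (h1 h2 : Hm y z),
      comp (a *: h1 + h2) g = a *: comp h1 g + comp h2 g;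
  comp_linr : forall (x y z : Ob) (h : Hm y z) (a : k) (g1 g2 : Hm x y),
      comp h (a *: g1 + g2) = a *: comp h g1 + comp h g2;
  compA : forall (x y z w : Ob) (f : Hm x y) (g : Hm y z) (h : Hm z w),
      comp h (comp g f) = comp (comp h g) f;
  comp1l : forall (x y : Ob) (f : Hm x y), comp (idm y) f = f;
  comp1r : forall (x y : Ob) (f : Hm x y), comp f (idm x) = f;
  idm_neq0 : forall x : Ob, idm x != 0
}.
Arguments comp {k} _ {x y z}.
Arguments idm {k} _ x.

Section Defs.
Variable k : fieldType.
Variable E : klcat k.

Local Notation Obj := (Ob E).
Local Notation Hom := (@Hm k E).

Definition nzhom (x y : Obj) : Prop := exists f : Hom x y, f != 0.
Definition preceq : Obj -> Obj -> Prop := clos_trans Obj nzhom.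
Definition prec (x y : Obj) : Prop := preceq x y /\ ~ preceq y x.

(* Hom spaces are finite dimensional by construction (vectType). *)
Definition locally_finite : Prop :=
  forall x y : Obj, finite_set [set z | preceq x z /\ preceq z y].

Definition left_strictly_locally_finite : Prop :=
  locally_finite /\
  forall y : Obj, exists X : set Obj,
    [/\ finite_set X, (forall x, X x -> prec x y) &
     forall (z : Obj) (f : Hom z y), prec z y ->
       exists (n : nat) (xs : 'I_n -> Obj)
              (g : forall i, Hom z (xs i)) (h : forall i, Hom (xs i) y),
         (forall i, X (xs i)) /\ f = \sum_(i < n) comp E (h i) (g i)].

(* The coalgebra C_E = \bigoplus_{x,y} C^{x,y},  C^{x,y} = Hom_E(x,y)^*.   *)
Definition C (x y : Obj) : vectType k := 'Hom(Hom x y, k^o).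

Definition bas (x y : Obj) (i : 'I_(\dim {: Hom x y})) : Hom x y :=
  tnth (vbasis {: Hom x y}) i.
Definition dbas (x y : Obj) (i : 'I_(\dim {: Hom x y})) : C x y :=
  @linfun _ (Hom x y) k^o (coord (vbasis {: Hom x y}) i).

Definition hcast (x y x' y' : Obj) (e1 : x = x') (e2 : y = y') (f : Hom x y)
  : Hom x' y' :=
  eq_rect y (fun b => Hom x' b) (eq_rect x (fun a => Hom a y) f x' e1) y' e2.

Section Contra.
Variable P : lmodType k.

(* Hom_k(C_E, P) = \prod_{x,y} Hom_k(C^{x,y}, P): families of maps, which   *)
(* are required to be componentwise linear where relevant.                   *)
Definition Fam := forall x y : Obj, C x y -> P.

Definition islin (U V : lmodType k) (f : U -> V) : Prop :=
  forall (a : k) (u v : U), f (a *: u + v) = a *: f u + f v.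

Definition linfam (f : Fam) : Prop := forall x y, islin (f x y).

Definition famadd (a : k) (f g : Fam) : Fam :=
  fun x y c => a *: f x y c + g x y c.

Definition epsfam (p : P) : Fam := fun a b (c : C a b) =>
  match pselect (a = b) with
  | left e => (c (hcast (erefl a) e (idm E a)) : k) *: p
  | right _ => 0
  end.

Definition evfam (x y : Obj) (f : Hom x y) (p : P) : Fam := fun a b (c : C a b) =>
  match pselect (x = a) with
  | left e1 =>
      match pselect (y = b) with
      | left e2 => (c (hcast e1 e2 f) : k) *: p
      | right _ => 0
      end
  | right _ => 0
  end.

(* Elements of Hom_k(C, Hom_k(C, P)) ~ Hom_k(C (x) C, P):                    *)
(*   F a b c'' x y c'  corresponds to  c' (x) c'' |-> F(c'')(c').           *)
Definition Fam2 := forall a b : Obj, C a b -> Fam.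

Definition linfam2 (F : Fam2) : Prop :=
  (forall a b c, linfam (F a b c)) /\
  (forall a b (al : k) (c c' : C a b) x y (d : C x y),
      F a b (al *: c + c') x y d = al *: F a b c x y d + F a b c' x y d).

(* F o mu, where mu : C^{x,y} -> \bigoplus_z C^{x,z} (x) C^{z,y} is dual to  *)
(* composition: mu(xi) = sum_z sum_{i,j} xi(h_j g_i) g_i^* (x) h_j^*, with   *)
(* (g_i), (h_j) bases of Hom(x,z), Hom(z,y) and g_i^*, h_j^* dual bases.     *)
Definition comulfam (F : Fam2) : Fam := fun x y (xi : C x y) =>
  \sum_(z \in [set: Obj])
    \sum_(i < \dim {: Hom x z}) \sum_(j < \dim {: Hom z y})
      (xi (comp E (bas j) (bas i)) : k) *: F z y (dbas j) x z (dbas i).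

End Contra.

Record contra (P : lmodType k) := Contra {
  cpi : Fam P -> P;
  cpi_lin : forall (a : k) (f g : Fam P), linfam f -> linfam g ->
      cpi (famadd a f g) = a *: cpi f + cpi g;
  cpi_counit : forall p : P, cpi (epsfam p) = p;
  cpi_assoc : forall F : Fam2 P, linfam2 F ->
      cpi (fun a b c => cpi (F a b c)) = cpi (comulfam F)
}.

Definition contra_hom (P Q : lmodType k) (cP : contra P) (cQ : contra Q)
    (g : P -> Q) : Prop :=
  islin g /\
  forall f : Fam P, linfam f -> g (cpi cP f) = cpi cQ (fun x y c => g (f x y c)).

(* The functor Theta_E on objects: Theta(P)(x) = e_x . P  (a subspace of P), *)
(* with f : x -> y acting by p |-> ev_f . p.                                 *)
Definition Theta_obj (P : lmodType k) (cP : contra P) (x : Obj) : set P :=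
  [set q | exists p : P, q = cpi cP (evfam (idm E x) p)].

Definition Theta_act (P : lmodType k) (cP : contra P) (x y : Obj) (f : Hom x y)
    (p : P) : P := cpi cP (evfam f p).

(* Morphisms of left E-modules Theta(P) -> Theta(Q): families of linear maps *)
(* phi x : e_x P -> e_x Q, natural in x.  (phi x is given as a map P -> Q;   *)
(* only its restriction to e_x P matters.)                                   *)
Definition Emod_hom (P Q : lmodType k) (cP : contra P) (cQ : contra Q)
    (phi : forall x : Obj, P -> Q) : Prop :=
  [/\ (forall x p, Theta_obj cP x p -> Theta_obj cQ x (phi x p)),
      (forall x (a : k) p p', Theta_obj cP x p -> Theta_obj cP x p' ->
          phi x (a *: p + p') = a *: phi x p + phi x p') &
      (forall x y (f : Hom x y) p, Theta_obj cP x p ->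
          phi y (Theta_act cP f p) = Theta_act cQ f (phi x p))].

(* Theta on morphisms is restriction; Theta is fully faithful if the induced *)
(* map Hom_contra(P,Q) -> Hom_E(Theta P, Theta Q) is injective and surjective*)
(* (E-module morphisms being equal iff they agree on every e_x P).           *)
Definition Theta_faithful : Prop :=
  forall (P Q : lmodType k) (cP : contra P) (cQ : contra Q) (g1 g2 : P -> Q),
    contra_hom cP cQ g1 -> contra_hom cP cQ g2 ->
    (forall x p, Theta_obj cP x p -> g1 p = g2 p) -> g1 = g2.

Definition Theta_full : Prop :=
  forall (P Q : lmodType k) (cP : contra P) (cQ : contra Q)
         (phi : forall x : Obj, P -> Q),
    Emod_hom cP cQ phi ->
    exists g : P -> Q, contra_hom cP cQ g /\
      (forall x p, Theta_obj cP x p -> g p = phi x p).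

Definition Theta_fully_faithful : Prop := Theta_faithful /\ Theta_full.

End Defs.

(* Main.v *)
(* A contramodule is determined by its components e_x P, so only fullness needs
   the finiteness hypothesis. A morphism of E-modules extends to a linear map,
   and the defect at y measures, for a family t of elements indexed by all
   morphisms x -> y, the failure of this map to commute with the infinite sum of
   t. The defect vanishes on families with finite support, hence only the
   objects x < y matter. Morphisms from these factor through the finite set X_y,
   which writes a defect at y as a finite sum of h_j d_j, with d_j a defect at
   some w < y and h_j : w -> y. A Nakayama-type argument, which sums the infinite
   tree of iterated expansions inside the target contramodule, then shows that
   all defects vanish. *)
From mathcomp Require Import all_boot all_order all_algebra.
From mathcomp Require Import boolp classical_sets cardinality fsbigop finmap.
From Stdlib Require Import Relations.
Require Import Defs.

Set Implicit Arguments.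
Unset Strict Implicit.
Unset Printing Implicit Defensive.
Import GRing.Theory.

(** * Linear maps in the sense of [islin] *)

Section LinearMaps.
Local Open Scope ring_scope.
Variables (k : fieldType) (U V : lmodType k).
Implicit Types f g : U -> V.

Lemma islin0 f : islin f -> f 0 = 0.
Proof. by move=> fL; have := fL (-1) 0 0; rewrite scaler0 addr0 scaleN1r addNr. Qed.

Lemma islinD f u v : islin f -> f (u + v) = f u + f v.
Proof. by move=> fL; have := fL 1 u v; rewrite !scale1r. Qed.

Lemma islinZ f a u : islin f -> f (a *: u) = a *: f u.
Proof. by move=> fL; have := fL a u 0; rewrite (islin0 fL) !addr0. Qed.

Lemma islinB f u v : islin f -> f (u - v) = f u - f v.
Proof. by move=> fL; rewrite -scaleN1r addrC fL scaleN1r addrC. Qed.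

Lemma islin_sum f (I : Type) (r : seq I) (u : I -> U) :
  islin f -> f (\sum_(i <- r) u i) = \sum_(i <- r) f (u i).
Proof.
by move=> fL; apply: big_morph => [x y|]; [apply: islinD | apply: islin0].
Qed.

Lemma islin_bigsum (I : Type) (r : seq I) (f : I -> U -> V) :
  (forall i, islin (f i)) -> islin (fun u => \sum_(i <- r) f i u).
Proof.
move=> fL a u v; rewrite scaler_sumr -big_split.
by apply: eq_bigr => i _; apply: fL.
Qed.

End LinearMaps.

Lemma islin_comp (k : fieldType) (U V W : lmodType k) (g : V -> W) (f : U -> V) :
  islin g -> islin f -> islin (fun u => g (f u)).
Proof. by move=> gL fL a u v; rewrite fL gL. Qed.

(** * Families of maps on the components of the coalgebra, and their comultiplication *)

Section Families.
Local Open Scope ring_scope.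
Local Open Scope classical_set_scope.
Variables (k : fieldType) (E : klcat k) (P : lmodType k).
Local Notation Obj := (Ob E).
Local Notation Hom := (@Hm k E).
Implicit Types (x y z w a b : Obj) (p q : P) (s t : Fam E P).

Lemma fam_ext s t : (forall x y (c : C x y), s x y c = t x y c) -> s = t.
Proof.
move=> st; apply: functional_extensionality_dep => x.
by apply: functional_extensionality_dep => y; apply/funext => c.
Qed.

Lemma bas_expand x y (f : Hom x y) :
  f = \sum_(i < \dim {: Hom x y}) (dbas i f : k) *: bas i.
Proof.
rewrite [LHS](@coord_vbasis _ _ f {: Hom x y}) ?memvf//.
apply: eq_bigr => i _; rewrite /dbas lfunE /bas.
by rewrite (tnth_nth 0).
Qed.

Lemma C_expand x y (c : C x y) :
  c = \sum_(i < \dim {: Hom x y}) (c (bas i) : k) *: dbas i.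
Proof.
apply/lfunP => f; rewrite [in LHS](bas_expand f) linear_sum sum_lfunE.
apply: eq_bigr => i _; rewrite linearZ scale_lfunE /=.
exact: mulrC.
Qed.

Lemma linfam_expand t x y (c : C x y) : linfam t ->
  t x y c = \sum_(i < \dim {: Hom x y}) (c (bas i) : k) *: t x y (dbas i).
Proof.
move=> tL; rewrite [in LHS](C_expand c) (islin_sum _ _ (tL x y)).
by apply: eq_bigr => i _; rewrite (islinZ _ _ (tL x y)).
Qed.

Lemma evfamE x y (f : Hom x y) p (c : C x y) : evfam f p c = (c f : k) *: p.
Proof.
rewrite /evfam; case: pselect => // e1; case: pselect => // e2.
by rewrite (Prop_irrelevance e1 erefl) (Prop_irrelevance e2 erefl).
Qed.

Lemma evfam_neql x y (f : Hom x y) p a b (c : C a b) : x <> a -> evfam f p c = 0.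
Proof. by rewrite /evfam; case: pselect. Qed.

Lemma evfam_neqr x y (f : Hom x y) p a b (c : C a b) : y <> b -> evfam f p c = 0.
Proof. by rewrite /evfam; case: pselect => // ?; case: pselect. Qed.

(** Removes the dependent casts of [evfam] once and for all: on a fixed [c] it is, uniformly in the
    morphism and the element, either zero or a scalar multiple. *)
Lemma evfam_ind x y a b (c : C a b) (K : (Hom x y -> P -> P) -> Prop) :
  K (fun _ _ => 0) -> (forall c' : C x y, K (fun f p => (c' f : k) *: p)) ->
  K (fun f p => evfam f p c).
Proof.
move=> K0 K1; case: (pselect (x = a)) => [e1|n1]; last first.
  rewrite (_ : (fun f p => _) = fun _ _ => 0) //.
  by apply/funext => f; apply/funext => p; rewrite evfam_neql.
case: (pselect (y = b)) => [e2|n2]; last first.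
  rewrite (_ : (fun f p => _) = fun _ _ => 0) //.
  by apply/funext => f; apply/funext => p; rewrite evfam_neqr.
subst a b; rewrite (_ : (fun f p => _) = fun f p => (c f : k) *: p) //.
by apply/funext => f; apply/funext => p; rewrite evfamE.
Qed.

Lemma evfam_lin x y (f : Hom x y) p : linfam (evfam f p).
Proof.
move=> a b al c c'.
case: (pselect (x = a)) => [e1|n1]; last by rewrite !evfam_neql// scaler0 addr0.
case: (pselect (y = b)) => [e2|n2]; last by rewrite !evfam_neqr// scaler0 addr0.
by subst; rewrite !evfamE add_lfunE scale_lfunE scalerDl scalerA.
Qed.

Lemma evfam_linr x y (f : Hom x y) a b (c : C a b) : islin (fun p => evfam f p c).
Proof.
apply: (@evfam_ind x y a b c (fun F => islin (F f))) => [|c'] al p q.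
  by rewrite scaler0 addr0.
by rewrite scalerDr !scalerA mulrC.
Qed.

Lemma evfam_linl x y p a b (c : C a b) : islin (fun f : Hom x y => evfam f p c).
Proof.
apply: (@evfam_ind x y a b c (fun F => islin (fun f => F f p))) => [|c'] al f g.
  by rewrite scaler0 addr0.
by rewrite linearP scalerDl scalerA.
Qed.

Lemma epsfamE p a b (c : C a b) : epsfam p c = evfam (idm E a) p c.
Proof.
rewrite /epsfam; case: pselect => [e|n]; last by rewrite evfam_neqr.
by subst b; rewrite evfamE.
Qed.

Lemma fsbig_single (f : Obj -> P) z0 :
  (forall z, z <> z0 -> f z = 0) -> \sum_(z \in [set: Obj]) f z = f z0.
Proof.
move=> f0; rewrite -(@fsbig_widen _ _ _ _ [set z0]) ?fsbig_set1//.
by move=> z /= [_ /f0].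
Qed.

(* Under a contraaction, [push h s] sums to [h] applied to the sum of [s]. *)
Definition push w y (h : Hom w y) (s : Fam E P) : Fam E P := fun x b c =>
  \sum_(i < \dim {: Hom x w}) evfam (comp E h (bas i)) (s x w (dbas i)) c.

(** Since [evfam h] is supported on [C w y], only [z = w] survives, and summing over the dual basis
    of [Hom w y] reassembles [h]. *)
Lemma comulfam_push w y (h : Hom w y) s x b (c : C x b) :
  comulfam (fun a b c x z d => evfam h (s x z d) c) c = push h s c.
Proof.
rewrite /comulfam (@fsbig_single _ w); last first.
  move=> z nz; rewrite big1 // => i _; rewrite big1 // => j _.
  by rewrite evfam_neql ?scaler0//; apply: nesym.
apply: eq_bigr => i _.
case: (pselect (y = b)) => [e|n]; last first.
  rewrite evfam_neqr // big1 // => j _.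
  by rewrite evfam_neqr ?scaler0.
subst b; rewrite evfamE.
under eq_bigr do rewrite evfamE scalerA.
rewrite -scaler_suml; congr (_ *: _).
have L : islin (fun h : Hom w y => (c (comp E h (bas i)) : k^o)).
  by move=> a u v; rewrite comp_linl linearP.
rewrite [in RHS](bas_expand h) [RHS](islin_sum _ _ L).
by apply: eq_bigr => j _; rewrite [RHS](islinZ _ _ L) mulrC.
Qed.

(** The counit law: only [z = x] survives, and the coordinates of [idm E x] reassemble the
    identity. *)
Lemma comulfam_id t x b (c : C x b) : linfam t ->
  comulfam (fun a b (c : C a b) x z d => evfam (idm E a) (t a b c) d) c = t x b c.
Proof.
move=> tL; rewrite /comulfam (@fsbig_single _ x); last first.
  move=> z nz; rewrite big1 // => i _; rewrite big1 // => j _.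
  by rewrite evfam_neql ?scaler0.
rewrite (linfam_expand _ tL) exchange_big /=; apply: eq_bigr => j _.
under eq_bigr do rewrite evfamE scalerA.
rewrite -scaler_suml; congr (_ *: _).
have L : islin (fun f : Hom x x => (c (comp E (bas j) f) : k^o)).
  by move=> a u v; rewrite comp_linr linearP.
rewrite -[in RHS](comp1r (bas j)) [in RHS](bas_expand (idm E x)) [RHS](islin_sum _ _ L).
by apply: eq_bigr => i _; rewrite [RHS](islinZ _ _ L) mulrC.
Qed.

Lemma push_lin w y (h : Hom w y) s : linfam (push h s).
Proof. by move=> x b; apply: islin_bigsum => i; apply: evfam_lin. Qed.

Lemma push_evfam u w y (h : Hom w y) (g : Hom u w) p : 
  push h (evfam g p) = evfam (comp E h g) p.
Proof.
apply: fam_ext => x b c; rewrite /push.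
case: (pselect (u = x)) => [e|n]; last first.
  rewrite [RHS]evfam_neql // big1 // => i _.
  by rewrite (evfam_neql g p _ n) (islin0 (@evfam_linr _ _ _ _ _ _)).
subst x; have L : islin (fun g : Hom u w => evfam (comp E h g) p c).
  by move=> a f f'; rewrite comp_linr evfam_linl.
rewrite [in RHS](bas_expand g) [RHS](islin_sum _ _ L).
apply: eq_bigr => i _; rewrite [RHS](islinZ _ _ L).
by rewrite evfamE (islinZ _ _ (@evfam_linr _ _ _ _ _ _)).
Qed.

Lemma push_ext w y (h : Hom w y) s t x b (c : C x b) :
  (forall d : C x w, s x w d = t x w d) -> push h s c = push h t c.
Proof. by move=> st; apply: eq_bigr => i _; rewrite st. Qed.

Lemma push_sum (I : Type) (r : seq I) w y (h : Hom w y) (t : I -> Fam E P)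
    x b (c : C x b) :
  push h (fun x z d => \sum_(i <- r) t i x z d) c = \sum_(i <- r) push h (t i) c.
Proof.
rewrite /push exchange_big; apply: eq_bigr => j _.
exact: (islin_sum _ _ (@evfam_linr _ _ _ _ _ _)).
Qed.

Lemma linfam_sum (I : Type) (r : seq I) (t : I -> Fam E P) :
  (forall i, linfam (t i)) -> linfam (fun x y c => \sum_(i <- r) t i x y c).
Proof. by move=> tL x y; apply: islin_bigsum => i; apply: tL. Qed.

(** The sum over [z] in [comulfam] is zero by convention on infinite supports, hence not additive in
    general. With each [F i] concentrated at a single [z], all sums run over one finite list. *)
Lemma comulfam_sum (I : Type) (r : seq I) (F : I -> Fam2 E P) x b (c : C x b) :
  (forall i, exists z0 : Obj, forall z, z <> z0 ->
     forall (c : C z b) (d : C x z), F i z b c x z d = 0) ->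
  comulfam (fun a b c x z d => \sum_(i <- r) F i a b c x z d) c =
  \sum_(i <- r) comulfam (F i) c.
Proof.
move=> /(_ _)/cid H.
have [z0 F0] : {z0 : I -> Obj | forall i z, z <> z0 i ->
    forall (c : C z b) (d : C x z), F i z b c x z d = 0}.
  by exists (fun i => sval (H i)) => i; apply: (svalP (H i)).
have comulE (s : seq Obj) (G : Fam2 E P) : uniq s ->
    (forall z, z \notin s -> forall (c : C z b) (d : C x z), G z b c x z d = 0) ->
    comulfam G c = \sum_(z <- s) \sum_(i < \dim {: Hom x z})
      \sum_(j < \dim {: Hom z b})
        (c (comp E (bas j) (bas i)) : k) *: G z b (dbas j) x z (dbas i).
  move=> us G0; rewrite fsbig_seq //; symmetry; apply: fsbig_widen => // z /=.
  move=> [_ /negP /G0 Gz]; rewrite big1 // => i _; rewrite big1 // => j _.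
  by rewrite Gz scaler0.
pose s := undup [seq z0 i | i <- r].
have : all (mem s) [seq z0 i | i <- r] by apply/allP => z; rewrite -mem_undup.
have us : uniq s by apply: undup_uniq.
(* Generalizing [s] keeps the list fixed during the inductions on [r]. *)
move: s us => s us rs; rewrite (comulE s) //; last first.
  move=> z zs ? ?; elim: r rs => [|i r IH] /=; rewrite ?big_nil // big_cons.
  move=> /andP[is_ /IH ->]; rewrite F0 ?addr0 // => e.
  by move: zs; rewrite e is_.
elim: r rs => [|i r IH] /= => [_|/andP[is_ /IH {}IH]].
  rewrite big_nil; apply: big1 => z _; apply: big1 => i _; apply: big1 => j _.
  by rewrite big_nil scaler0.
rewrite big_cons -IH (comulE s) //; last first.
  by move=> z zs; apply: F0 => e; move: zs; rewrite e is_.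
rewrite -big_split; apply: eq_bigr => z _.
rewrite -big_split; apply: eq_bigr => i' _.
rewrite -big_split; apply: eq_bigr => j _.
by rewrite big_cons scalerDr.
Qed.

End Families.

Lemma evfam_morph (k : fieldType) (E : klcat k) (P Q : lmodType k) (g : P -> Q)
    (x y a b : Ob E) (f : Hm x y) (p : P) (c : C a b) :
  islin g -> g (evfam f p c) = evfam f (g p) c.
Proof.
move=> gL; case: (pselect (x = a)) => [e1|n1]; last first.
  by rewrite !(evfam_neql _ _ _ n1) islin0.
case: (pselect (y = b)) => [e2|n2]; last first.
  by rewrite !(evfam_neqr _ _ _ n2) islin0.
by subst; rewrite !evfamE islinZ.
Qed.

(** * The contraaction, the action of morphisms and the components of a contramodule *)

Section Contramodule.
Local Open Scope ring_scope.
Variables (k : fieldType) (E : klcat k) (P : lmodType k) (cP : contra E P).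
Local Notation Obj := (Ob E).
Local Notation Hom := (@Hm k E).
Local Notation pi := (cpi cP).
Local Notation act := (Theta_act cP).
Implicit Types (x y z w a b : Obj) (p q : P) (s t : Fam E P).

Lemma cpi0 : pi (fun x y c => 0) = 0.
Proof.
have L : linfam (fun x y (c : C x y) => 0 : P).
  by move=> x y al u v; rewrite scaler0 addr0.
have := cpi_lin cP (-1) L L; rewrite scaleN1r addNr => pi0; rewrite -[RHS]pi0.
by congr pi; apply: fam_ext => x y c; rewrite /famadd scaler0 addr0.
Qed.

Lemma cpiD s t : linfam s -> linfam t ->
  pi (fun x y c => s x y c + t x y c) = pi s + pi t.
Proof.
move=> sL tL; rewrite -[pi s]scale1r -cpi_lin //.
by congr pi; apply: fam_ext => x y c; rewrite /famadd scale1r.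
Qed.

Lemma cpiZ (al : k) t : linfam t -> pi (fun x y c => al *: t x y c) = al *: pi t.
Proof.
move=> tL; rewrite -[RHS]addr0 -[X in _ + X]cpi0 -cpi_lin //; last first.
  by move=> x y be u v; rewrite scaler0 addr0.
by congr pi; apply: fam_ext => x y c; rewrite /famadd addr0.
Qed.

Lemma cpi_sum (I : Type) (r : seq I) (t : I -> Fam E P) :
  (forall i, linfam (t i)) ->
  pi (fun x y c => \sum_(i <- r) t i x y c) = \sum_(i <- r) pi (t i).
Proof.
move=> tL; elim: r => [|i r IH].
  rewrite big_nil -[RHS]cpi0.
  by congr pi; apply: fam_ext => x y c; rewrite big_nil.
rewrite big_cons -IH -cpiD //; last exact: linfam_sum.
by congr pi; apply: fam_ext => x y c; rewrite big_cons.
Qed.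

Lemma cpi_evfam w y (h : Hom w y) s a b (c : C a b) : linfam s ->
  pi (fun x z d => evfam h (s x z d) c) = evfam h (pi s) c.
Proof.
move=> sL.
apply: (@evfam_ind _ _ _ w y a b c
  (fun K => pi (fun x z d => K h (s x z d)) = K h (pi s))) => [|c'].
  exact: cpi0.
exact: cpiZ.
Qed.

Lemma act_linr x y (f : Hom x y) : islin (act f).
Proof.
move=> al p q; rewrite /Theta_act -cpi_lin; try exact: evfam_lin.
by congr pi; apply: fam_ext => a b c; rewrite evfam_linr.
Qed.

(** Contraassociativity for the family [F] below: contracting [s] first yields [evfam h (pi s)],
    comultiplying first yields [push h s]. *)
Lemma act_cpi w y (h : Hom w y) s : linfam s -> act h (pi s) = pi (push h s).
Proof.
move=> sL; pose F : Fam2 E P := fun a b c x z d => evfam h (s x z d) c.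
have FL : linfam2 F.
  split=> [a b c x z|a b al c c' x y' d]; last exact: evfam_lin.
  exact: (islin_comp (@evfam_linr _ _ _ _ _ h a b c) (sL x z)).
rewrite [LHS](_ : _ = pi (fun a b c => pi (F a b c))); last first.
  by congr pi; apply: fam_ext => a b c; rewrite cpi_evfam.
rewrite cpi_assoc //; congr pi; apply: fam_ext => x b c.
exact: comulfam_push.
Qed.

Lemma act_comp u w y (h : Hom w y) (g : Hom u w) p :
  act (comp E h g) p = act h (act g p).
Proof. by rewrite [act g p]/Theta_act act_cpi ?push_evfam //; apply: evfam_lin. Qed.

Lemma act1_act x y (f : Hom x y) p : act (idm E y) (act f p) = act f p.
Proof. by rewrite -act_comp comp1l. Qed.

Lemma act_act1 x y (f : Hom x y) p : act f (act (idm E x) p) = act f p.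
Proof. by rewrite -act_comp comp1r. Qed.

Lemma act1_neq x y p : x <> y -> act (idm E x) (act (idm E y) p) = 0.
Proof.
move=> n; rewrite [act (idm E y) p]/Theta_act act_cpi; last exact: evfam_lin.
rewrite -[RHS]cpi0; congr pi; apply: fam_ext => a b c.
apply: big1 => i _; rewrite (evfam_neqr (idm E y) p _ (nesym n)).
exact: islin0 (@evfam_linr _ _ _ _ _ _ _ _ _).
Qed.

(** [push (idm E y)] reads only the components [C x y] of a family. *)
Lemma act1_cpi_ext y s t : linfam s -> linfam t ->
  (forall x (c : C x y), s x y c = t x y c) ->
  act (idm E y) (pi s) = act (idm E y) (pi t).
Proof.
move=> sL tL st; rewrite !act_cpi //; congr pi; apply: fam_ext => x b c.
by apply: eq_bigr => i _; rewrite st.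
Qed.

(** Contraassociativity again, now with [idm E a] evaluated on the inner argument: comultiplying
    collapses by [comulfam_id]. *)
Lemma cpi_act1 t : linfam t ->
  pi (fun a b c => act (idm E a) (t a b c)) = pi t.
Proof.
move=> tL.
pose F : Fam2 E P := fun a b c x z d => evfam (idm E a) (t a b c) d.
rewrite -[LHS]/(pi (fun a b c => pi (F a b c))) cpi_assoc.
  by congr pi; apply: fam_ext => x b c; apply: comulfam_id.
split=> [a b c|a b al c c' x z d]; first exact: evfam_lin.
by rewrite /F tL evfam_linr.
Qed.

(** The counit axiom presents [p] as a contraaction, and [cpi_act1] then projects every value to its
    component. *)
Lemma cpi_components p :
  p = pi (fun a b c => evfam (idm E a) (act (idm E a) p) c).
Proof.
rewrite -[LHS](cpi_counit cP) -cpi_act1.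
  by congr pi; apply: fam_ext => a b c; rewrite epsfamE evfam_morph //; apply: act_linr.
by move=> a b al c c'; rewrite !epsfamE evfam_lin.
Qed.

Lemma act1_inj p q : (forall x, act (idm E x) p = act (idm E x) q) -> p = q.
Proof.
move=> pq; rewrite (cpi_components p) (cpi_components q).
by congr pi; apply: fam_ext => a b c; rewrite pq.
Qed.

Lemma Theta_objE x p : Theta_obj cP x p -> act (idm E x) p = p.
Proof. by case=> q ->; apply: act1_act. Qed.

Lemma Theta_obj_act1 x p : Theta_obj cP x (act (idm E x) p).
Proof. by exists p. Qed.

End Contramodule.

(** * A Nakayama-type lemma for contramodules *)

Section Nakayama.
Local Open Scope ring_scope.
Variables (k : fieldType) (E : klcat k) (P : lmodType k) (cP : contra E P).
Local Notation Obj := (Ob E).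
Local Notation Hom := (@Hm k E).
Local Notation pi := (cpi cP).
Local Notation act := (Theta_act cP).

Lemma preceq_refl (x : Obj) : preceq x x.
Proof. by apply: t_step; exists (idm E x); apply: idm_neq0. Qed.

Lemma preceq_trans (x y z : Obj) : preceq x y -> preceq y z -> preceq x z.
Proof. exact: t_trans. Qed.

(* [Tagged _ (h, q)] stands for the formal product of [h : x -> y] with an
   element [q] at [x]. *)
Definition node (y : Obj) := {x : Obj & (Hom x y * P)%type}.

Definition node_fam y (v : node y) : Fam E P := evfam (tagged v).1 (tagged v).2.

Definition node_val y (v : node y) : P := act (tagged v).1 (tagged v).2.

Definition node_comp y (v : node y) (c : node (tag v)) : node y :=
  Tagged _ (comp E (tagged v).1 (tagged c).1, (tagged c).2).

(** [D] stands for the class of elements to be shown zero. The factors lie in [D] again, at strictly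
    smaller objects, so that expansion can be iterated. *)
Definition expands (D : Obj -> P -> Prop) y q (s : seq (node y)) : Prop :=
  (forall v, v \in s -> prec (tag v) y /\ D (tag v) (tagged v).2) /\
  q = \sum_(v <- s) node_val v.

(** * The tree of iterated expansions of [q] *)

Section Tree.
Variables (D : Obj -> P -> Prop) (ch : forall y, P -> seq (node y)).
Hypothesis Efin : locally_finite E.
Hypothesis chP : forall y q, D y q -> expands D q (ch y q).
Variables (y : Obj) (q : P).
Hypothesis Dq : D y q.

Definition children (v : node y) : seq (node (tag v)) := ch (tag v) (tagged v).2.

Fixpoint level n : seq (node y) :=
  if n is n'.+1 then
    flatten [seq [seq node_comp c | c <- children v] | v <- level n']
  else [:: Tagged _ (idm E y, q)].

(** Grows strictly along branches, and so bounds the levels at which nodes over [x] occur. *)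
Definition depth (x : Obj) : nat :=
  #|` fset_set [set z | preceq x z /\ preceq z y]%classic|.

(** The interval from [z] to [y] is contained in the one from [x] to [y], and misses [x] itself. *)
Lemma depth_prec (x z : Obj) : prec x z -> preceq z y -> (depth z < depth x)%N.
Proof.
move=> [xz nzx] zy; have xy := preceq_trans xz zy.
have fin x' : finite_set [set z | preceq x' z /\ preceq z y]%classic by apply: Efin.
apply: fproper_ltn_card; rewrite fproperE; apply/andP; split.
  apply/fsubsetP => t; rewrite !in_fset_set // => /set_mem[zt ty].
  by apply/mem_set; split=> //; apply: preceq_trans zt.
apply/negP => /fsubsetP /(_ x); rewrite !in_fset_set //.
by move=> /(_ (mem_set (conj (preceq_refl x) xy)))/set_mem[].
Qed.

Lemma depth_gt0 : (0 < depth y)%N.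
Proof.
rewrite cardfs_gt0; apply/fset0Pn; exists y; rewrite in_fset_set.
  by apply/mem_set; split; apply: preceq_refl.
exact: Efin.
Qed.

Lemma levelP n v : v \in level n ->
  [/\ preceq (tag v) y, D (tag v) (tagged v).2 & (n < depth (tag v))%N].
Proof.
elim: n v => [|n IH] v /=.
  rewrite inE => /eqP -> /=; split => //; first exact: preceq_refl.
  exact: depth_gt0.
move=> /flatten_mapP[u /IH[uy Du nu]] /mapP[c cu ->] /=.
have [/(_ c cu)[cprec Dc] _] := chP Du; split => //.
  by case: cprec => cu' _; apply: preceq_trans uy.
exact: leq_ltn_trans nu (depth_prec cprec uy).
Qed.

Lemma node_comp_level n v (c : node (tag v)) :
  v \in level n -> c \in children v -> node_comp c \in level n.+1.
Proof. by move=> vn cv; apply/flatten_mapP; exists v => //; apply: map_f. Qed.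

Definition tree n : seq (node y) := flatten [seq level i | i <- index_iota 0 n].

Lemma big_tree (K : node y -> P) n :
  \sum_(v <- tree n) K v = \sum_(i < n) \sum_(v <- level i) K v.
Proof. by rewrite big_flatten big_map big_mkord. Qed.

Lemma tree_level n v : v \in tree n -> exists i, v \in level i.
Proof. by move=> /flatten_mapP[i _ vi]; exists i. Qed.

Lemma big_tree_stable (K : node y -> P) m n : (m <= n)%N ->
  (forall i v, (m <= i)%N -> v \in level i -> K v = 0) ->
  \sum_(v <- tree n) K v = \sum_(v <- tree m) K v.
Proof.
move=> /subnK <- K0; rewrite !big_tree addnC big_split_ord /= [X in _ + X]big1 ?addr0//.
move=> i _; apply: big1_seq => v /andP[_]; apply: K0; exact: leq_addr.
Qed.

(** Nodes below the root are the children of the nodes one level up, whence the cut-off [n.+1] on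
    one side and [n] on the other. *)
Lemma big_tree_rec (K : node y -> P) n : \sum_(v <- tree n.+1) K v =
  K (Tagged _ (idm E y, q)) + \sum_(v <- tree n) \sum_(c <- children v) K (node_comp c).
Proof.
rewrite !big_tree big_ord_recl /= big_seq1; congr (_ + _).
apply: eq_bigr => i _; rewrite big_flatten big_map.
by apply: eq_bigr => v _; rewrite big_map.
Qed.

Definition children_fam (v : node y) : Fam E P := fun x z d =>
  \sum_(c <- children v) node_fam c d.

Lemma children_fam_lin v : linfam (children_fam v).
Proof. by apply: linfam_sum => c; apply: evfam_lin. Qed.

Lemma cpi_children_fam n v : v \in level n -> pi (children_fam v) = (tagged v).2.
Proof.
move=> /levelP[_ /chP[_ ->] _]; rewrite cpi_sum // => c; exact: evfam_lin.
Qed.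

Lemma push_children_fam v x b (c : C x b) :
  push (tagged v).1 (children_fam v) c =
  \sum_(e <- children v) node_fam (node_comp e) c.
Proof.
by rewrite push_sum; apply: eq_bigr => e _; rewrite push_evfam.
Qed.

(** The formal sum of all nodes of the infinite tree: levels from [depth x] on contain no node over
    [x], so the cut-off loses nothing. *)
Definition tree_fam : Fam E P := fun x b c =>
  \sum_(v <- tree (depth x)) node_fam v c.

(** In each node the element is replaced by the family of its children, which contracts back to it.
    The cut-off depends on the object [x] of the inner argument, which stays fixed in the sum
    defining the comultiplication. *)
Definition tree_fam2 : Fam2 E P := fun a b c x z d =>
  \sum_(v <- tree (depth x)) evfam (tagged v).1 (children_fam v d) c.

Lemma tree_fam2_lin : linfam2 tree_fam2.
Proof.
split=> [a b c x z|a b al c c' x z d].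
  apply: islin_bigsum => v; move=> al d d'.
  by rewrite children_fam_lin evfam_linr.
rewrite /tree_fam2 scaler_sumr -big_split; apply: eq_bigr => v _.
exact: evfam_lin.
Qed.

Lemma comulfam_tree_fam2 x b (c : C x b) : comulfam tree_fam2 c =
  \sum_(v <- tree (depth x)) \sum_(e <- children v) node_fam (node_comp e) c.
Proof.
transitivity (comulfam (fun a b c x' z d => \sum_(v <- tree (depth x))
  evfam (tagged v).1 (children_fam v (d : C x' z)) (c : C a b)) c) => //.
rewrite (@comulfam_sum _ _ _ _ _ (fun v a b c x' z d =>
  evfam (tagged v).1 (children_fam v (d : C x' z)) (c : C a b))); last first.
  by move=> v; exists (tag v) => z nz *; rewrite evfam_neql //; apply: nesym.
by apply: eq_bigr => v _; rewrite comulfam_push push_children_fam.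
Qed.

Lemma cpi_tree_fam2 a b (c : C a b) : pi (tree_fam2 c) = tree_fam c.
Proof.
transitivity (pi (fun x z d => \sum_(v <- tree (depth a))
    evfam (tagged v).1 (children_fam v d) c)).
  congr pi; apply: fam_ext => x z d; rewrite /tree_fam2.
  (* [pi] needs a cut-off independent of [x]. Both [depth x] and [depth a] can be raised to their
     sum: nodes beyond the first have no children over [x], and nodes beyond the second do not lie
     over [a]. *)
  rewrite -(@big_tree_stable _ (depth x) (depth a + depth x)) ?leq_addl //; last first.
    move=> i v xi vi; rewrite /children_fam big1_seq.
      exact: islin0 (@evfam_linr _ _ _ _ _ _ _ _ _).
    move=> e /andP[_ ev]; rewrite /node_fam evfam_neql // => ex.
    have [_ _ /=] := levelP (node_comp_level vi ev).
    by rewrite ex ltnNge (leq_trans xi).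
  rewrite (@big_tree_stable _ (depth a)) ?leq_addr // => i v ai vi.
  rewrite evfam_neql // => va; have [_ _] := levelP vi.
  by rewrite va ltnNge ai.
rewrite cpi_sum => [|v x z]; last first.
  by move=> al d d'; rewrite children_fam_lin evfam_linr.
apply: eq_big_seq => v /tree_level[i vi].
by rewrite cpi_evfam ?(cpi_children_fam vi) //; apply: children_fam_lin.
Qed.

(** Splits off the root; raising the cut-off by one level adds no node over [x]. *)
Lemma tree_fam_rec x b (c : C x b) :
  tree_fam c = evfam (idm E y) q c + comulfam tree_fam2 c.
Proof.
rewrite comulfam_tree_fam2 -(big_tree_rec (fun v => node_fam v c)).
rewrite (@big_tree_stable _ (depth x)) // => i v xi /levelP[_ _ iv].
rewrite /node_fam evfam_neql // => vx.
by move: iv; rewrite vx ltnNge xi.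
Qed.

(** Contraassociativity for [tree_fam2] identifies the sum of the nodes below the root with the sum
    of all nodes, so the root contributes zero. *)
Lemma tree_root_eq0 : q = 0.
Proof.
(* The root node contributes only the projection of [q] to the component at [y]; as a sum of values
   of morphisms into [y], [q] lies in that component. *)
have -> : q = act (idm E y) q.
  have [_ ->] := chP Dq; rewrite (islin_sum _ _ (act_linr _ _)).
  by apply: eq_bigr => v _; rewrite act1_act.
have : pi tree_fam = act (idm E y) q + pi (comulfam tree_fam2).
  rewrite -cpiD; first last.
  - rewrite (fam_ext (fun x b => @comulfam_tree_fam2 x b)).
    move=> x b; apply: (@islin_bigsum _ _ _ _ _ (fun v (c : C x b) =>
      \sum_(e <- children v) node_fam (node_comp e) c)) => v.
    by apply: islin_bigsum => e; apply: evfam_lin.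
  - exact: evfam_lin.
  by congr pi; apply: fam_ext => x b c; apply: tree_fam_rec.
rewrite -cpi_assoc; last exact: tree_fam2_lin.
rewrite [X in _ + pi X](_ : _ = tree_fam); last first.
  by apply: fam_ext => a b c; apply: cpi_tree_fam2.
by rewrite -[LHS]add0r => /addIr.
Qed.

End Tree.

(* Iterating the expansion of [q] gives a finitely branching tree of formal
   products [m_v q_v], with only finitely many nodes over each object because
   the objects decrease along branches. The infinite sum [S] of all of its
   nodes satisfies [S = q + S]. *)
Lemma nakayama (D : Obj -> P -> Prop) : locally_finite E ->
  (forall y q, D y q -> exists s : seq (node y), expands D q s) ->
  forall y q, D y q -> q = 0.
Proof.
move=> Efin expD y q Dq.
have chD y' q' : {s : seq (node y') | D y' q' -> expands D q' s}.
  apply: cid; case: (pselect (D y' q')) => [/expD[s]|nD]; first by exists s.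
  by exists [::].
exact: (tree_root_eq0 Efin (fun y q => svalP (chD y q)) Dq).
Qed.

End Nakayama.

(** * Contramodule morphisms and faithfulness *)

Section Morphisms.
Local Open Scope ring_scope.
Variables (k : fieldType) (E : klcat k) (P Q : lmodType k).
Variables (cP : contra E P) (cQ : contra E Q).

Lemma contra_hom_act (g : P -> Q) (x y : Ob E) (f : Hm x y) p :
  contra_hom cP cQ g -> g (Theta_act cP f p) = Theta_act cQ f (g p).
Proof.
move=> [gL gpi]; rewrite /Theta_act gpi; last exact: evfam_lin.
congr (cpi cQ); apply: fam_ext => a b c.
exact: evfam_morph.
Qed.

End Morphisms.

(** Contramodule morphisms commute with the projections to components, and these determine an
    element of [Q]. *)
Lemma Theta_is_faithful (k : fieldType) (E : klcat k) : Theta_faithful E.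
Proof.
move=> P Q cP cQ g1 g2 g1hom g2hom g12; apply/funext => p.
apply: (act1_inj (cP := cQ)) => x.
rewrite -(contra_hom_act _ _ g1hom) -(contra_hom_act _ _ g2hom).
by apply: g12; apply: Theta_obj_act1.
Qed.

(** * A normal form for factorizations *)

Section Factorization.
Local Open Scope ring_scope.
Variables (k : fieldType) (E : klcat k).

Lemma comp_islinl (x y z : Ob E) (g : Hm x y) :
  islin (fun h : Hm y z => comp E h g).
Proof. by move=> a u v; apply: comp_linl. Qed.

Lemma comp_islinr (x y z : Ob E) (h : Hm y z) :
  islin (fun g : Hm x y => comp E h g).
Proof. by move=> a u v; apply: comp_linr. Qed.

(** Moves all dependence on the factored morphism into the first factors. The second factors become
    bases of the [Hm w y], so that one finite list of them serves the morphisms from all objects [z]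
    at once. *)
Lemma factor_bas (s : seq (Ob E)) (z y : Ob E) n (xs : 'I_n -> Ob E)
    (g : forall i, Hm z (xs i)) (h : forall i, Hm (xs i) y) :
  uniq s -> (forall i, xs i \in s) ->
  exists G : forall w, 'I_(\dim {: Hm w y}) -> Hm z w,
    \sum_(i < n) comp E (h i) (g i) =
    \sum_(w <- s) \sum_(j < \dim {: Hm w y}) comp E (bas j) (G w j).
Proof.
move=> us xss.
(* The [j]-th coordinate of [h i] is moved onto [g i], provided that [xs i] is [w]. *)
pose Gi i w (j : 'I_(\dim {: Hm w y})) : Hm z w :=
  match pselect (xs i = w) with
  | left e => (dbas j (hcast e erefl (h i)) : k) *: hcast erefl e (g i)
  | right _ => 0
  end.
exists (fun w j => \sum_(i < n) Gi i w j).
under [RHS]eq_bigr do under eq_bigr do rewrite (islin_sum _ _ (comp_islinr _)).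
under [RHS]eq_bigr do rewrite exchange_big.
rewrite exchange_big; apply: eq_bigr => i _ /=.
rewrite (bigD1_seq (xs i)) //= [X in _ + X]big1 ?addr0.
  rewrite [X in comp E X _](bas_expand (h i)) (islin_sum _ _ (comp_islinl _)).
  apply: eq_bigr => j _; rewrite /Gi; case: pselect => // e.
  rewrite (Prop_irrelevance e erefl) /=.
  rewrite (islinZ _ _ (comp_islinr (bas j))).
  exact: islinZ (comp_islinl (g i)).
move=> w wx; apply: big1 => j _; rewrite /Gi; case: pselect => [e|_].
  by rewrite e eqxx in wx.
exact: islin0 (comp_islinr _).
Qed.

End Factorization.

(** * Fullness: extending a morphism of modules to the contramodules *)

Section Fullness.
Local Open Scope ring_scope.
Variables (k : fieldType) (E : klcat k) (P Q : lmodType k).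
Variables (cP : contra E P) (cQ : contra E Q) (phi : forall x : Ob E, P -> Q).
Hypothesis phi_hom : Emod_hom cP cQ phi.
Local Notation Obj := (Ob E).
Local Notation Hom := (@Hm k E).
Local Notation actP := (Theta_act cP).
Local Notation actQ := (Theta_act cQ).
Implicit Types (x y z w a b : Obj) (p : P) (s t : Fam E P).

(* Precomposing with the projection onto [e_x P] makes [phi x] linear on [P]. *)
Definition psi x p : Q := phi x (actP (idm E x) p).

Definition psi_fam t : Fam E Q := fun x b c => psi x (t x b c).

Lemma psi_lin x : islin (psi x).
Proof.
move=> a p p'; have [_ phiL _] := phi_hom.
by rewrite /psi act_linr phiL //; apply: Theta_obj_act1.
Qed.

Lemma psi_act x y (f : Hom x y) p : psi y (actP f p) = actQ f (psi x p).
Proof.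
have [_ _ phiN] := phi_hom; rewrite /psi act1_act -(act_act1 cP f p).
by rewrite phiN //; apply: Theta_obj_act1.
Qed.

Lemma act1_psi x p : actQ (idm E x) (psi x p) = psi x p.
Proof. by rewrite -psi_act /psi act1_act. Qed.

Lemma psi_Theta_obj x p : Theta_obj cP x p -> psi x p = phi x p.
Proof. by move=> px; rewrite /psi (Theta_objE px). Qed.

Lemma psi_fam_lin t : linfam t -> linfam (psi_fam t).
Proof. by move=> tL x b al c c'; rewrite /psi_fam tL psi_lin. Qed.

Lemma psi_evfam x y (f : Hom x y) p : psi_fam (evfam f p) = evfam f (psi x p).
Proof.
apply: fam_ext => a b c; rewrite /psi_fam.
case: (pselect (x = a)) => [e|n]; last first.
  by rewrite !(evfam_neql _ _ _ n) (islin0 (@psi_lin a)).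
by subst a; apply: evfam_morph (@psi_lin x).
Qed.

Lemma psi_push w y (h : Hom w y) s : psi_fam (push h s) = push h (psi_fam s).
Proof.
apply: fam_ext => x b c; rewrite /psi_fam /push (islin_sum _ _ (@psi_lin x)).
by apply: eq_bigr => i _; rewrite (evfam_morph _ _ _ (@psi_lin x)).
Qed.

(* The [y]-component of the failure of [psi] to commute with the contraactions
   on the family [t]. *)
Definition defect y t : Q :=
  psi y (cpi cP t) - actQ (idm E y) (cpi cQ (psi_fam t)).

Lemma defect_ext y s t : linfam s -> linfam t ->
  (forall x (c : C x y), s x y c = t x y c) -> defect y s = defect y t.
Proof.
move=> sL tL st; rewrite /defect /psi (act1_cpi_ext cP sL tL st).
rewrite (act1_cpi_ext cQ (psi_fam_lin sL) (psi_fam_lin tL)) // => x c.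
by rewrite /psi_fam st.
Qed.

Lemma defect_sum (I : Type) (r : seq I) y (t : I -> Fam E P) :
  (forall i, linfam (t i)) ->
  defect y (fun x b c => \sum_(i <- r) t i x b c) = \sum_(i <- r) defect y (t i).
Proof.
move=> tL; rewrite /defect cpi_sum // (islin_sum _ _ (@psi_lin y)).
rewrite (_ : psi_fam _ = fun x b c => \sum_(i <- r) psi_fam (t i) c); last first.
  by apply: fam_ext => x b c; apply: islin_sum (@psi_lin x).
rewrite cpi_sum => [|i]; last exact: psi_fam_lin.
by rewrite (islin_sum _ _ (act_linr _ _)) sumrB.
Qed.

Lemma defectD y s t : linfam s -> linfam t ->
  defect y (fun x b c => s x b c + t x b c) = defect y s + defect y t.
Proof.
move=> sL tL.
have := @defect_sum bool [:: true; false] y (fun i : bool => if i then s else t).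
rewrite big_cons big_seq1 => <-; last by case.
by congr defect; apply: fam_ext => x b c; rewrite big_cons big_seq1.
Qed.

(** This is the naturality of [phi] for the single morphism [f]. *)
Lemma defect_evfam x y (f : Hom x y) p : defect y (evfam f p) = 0.
Proof.
rewrite /defect psi_evfam -/(actP f p) -/(actQ f (psi x p)).
by rewrite psi_act act1_act subrr.
Qed.

(** [push h] contracts to the action of [h] in both contramodules, and [psi] is natural. *)
Lemma defect_push w y (h : Hom w y) s : linfam s ->
  defect y (push h s) = actQ h (defect w s).
Proof.
move=> sL; rewrite /defect psi_push -!act_cpi //; last exact: psi_fam_lin.
by rewrite act1_act psi_act (islinB _ _ (act_linr _ _)) act_act1.
Qed.

Lemma preceq_hom x y (f : Hom x y) : ~ preceq x y -> f = 0.
Proof.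
move=> nxy; apply/eqP; apply: contrapT => /negP f0.
by apply: nxy; apply: t_step; exists f.
Qed.

(** On morphisms into [y], [t] agrees with a sum [L + M]. Here [L] covers the finitely many [x]
    equivalent to [y] and has zero defect; [M] covers the [x] strictly below [y] and is a finite sum
    of pushes, to which [defect_push] applies. *)
Lemma defect_expands y t : left_strictly_locally_finite E -> linfam t ->
  exists s : seq (node Q y),
    expands cQ (fun w q => exists2 t, linfam t & q = defect w t) (defect y t) s.
Proof.
move=> [Efin /(_ y)[X [/finite_seqP[s0 Xs] Xy fac]]] tL.
pose s := undup s0; have us : uniq s by apply: undup_uniq.
have sX w : w \in s -> prec w y by rewrite mem_undup => ws; apply: Xy; rewrite Xs.
(* The objects equivalent to [y] form the interval from [y] to [y], finite by local finiteness. *)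
have [A uA As] : exists2 A : seq Obj,
    uniq A & forall x, x \in A <-> preceq y x /\ preceq x y.
  have /finite_seqP[A eA] := Efin y y; exists (undup A); first exact: undup_uniq.
  by move=> x; rewrite mem_undup; have /= <- := congr1 (fun B : set Obj => B x) eA.
have HG x (i : 'I_(\dim {: Hom x y})) :
    exists G : forall w, 'I_(\dim {: Hom w y}) -> Hom x w, prec x y ->
    bas i = \sum_(w <- s) \sum_(j < \dim {: Hom w y}) comp E (bas j) (G w j).
  case: (pselect (prec x y)) => [xy|nxy]; last by exists (fun _ _ => 0).
  have [n [xs [g [h [xsX ->]]]]] := fac x (bas i) xy.
  have [|G ->] := @factor_bas _ _ s x y n xs g h us; last by exists G.
  by move=> j; rewrite mem_undup; have := xsX j; rewrite Xs.
pose G x i := sval (cid (HG x i)).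
(* [S w j] carries the values of [t] along the first factors, possibly for infinitely many [x]; its
   pushes along [bas j], summed over [w] and [j], restore [t] on morphisms from objects strictly
   below [y]. *)
pose S w j : Fam E P := fun x a c => if `[< prec x y >] then
  \sum_i evfam (G x i w j) (t x y (dbas i)) c else 0.
have SL w j : linfam (S w j).
  move=> x a al c c'; rewrite /S; case: ifP => _; last by rewrite scaler0 addr0.
  exact: linfam_sum (index_enum _) _ (fun i =>
    @evfam_lin _ _ _ _ _ (G x i w j) (t x y (dbas i))) _ _ _ _ _.
exists [seq (Tagged _ (bas j, defect w (S w j)) : node Q y)
  | w <- s, j <- index_enum 'I_(\dim {: Hom w y})].
split=> [v /allpairsPdep[w [j [ws _ ->]]] /=|].
  by split; [apply: sX | exists (S w j)].
rewrite big_allpairs_dep /node_val /=.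
(* The node values are gathered into the defect of one family, named [M] below. *)
under eq_bigr do under eq_bigr do rewrite -defect_push //.
under eq_bigr => w _.
  rewrite -(defect_sum _ _ (fun j => @push_lin _ _ _ _ _ (bas j) (S w j))).
  over.
rewrite -defect_sum; last by move=> w; apply: linfam_sum => j; apply: push_lin.
pose L : Fam E P := fun x b c =>
  \sum_(x' <- A) \sum_i evfam (bas i) (t x' y (dbas i)) c.
pose M : Fam E P := fun x b c => \sum_(w <- s) \sum_j push (bas j) (S w j) c.
have LL : linfam L.
  by apply: linfam_sum => x'; apply: linfam_sum => i; apply: evfam_lin.
have ML : linfam M.
  by apply: linfam_sum => w; apply: linfam_sum => j; apply: push_lin.
have L0 : defect y L = 0.
  rewrite defect_sum; last by move=> x'; apply: linfam_sum => i; apply: evfam_lin.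
  apply: big1 => x' _; rewrite defect_sum => [|i]; last exact: evfam_lin.
  by apply: big1 => i _; apply: defect_evfam.
rewrite -[RHS]/(defect y M) -[RHS]add0r -L0 -defectD //.
apply: defect_ext => //; first by move=> x b al c c'; rewrite LL ML scalerDr addrACA.
move=> x c; rewrite (linfam_expand _ tL).
have Lout : ~ (preceq y x /\ preceq x y) -> L x y c = 0.
  move=> nA; apply: big1_seq => x' /andP[_ /As x'A]; apply: big1 => i _.
  by rewrite evfam_neql // => e; apply: nA; rewrite -e.
have Mout : ~ prec x y -> M x y c = 0.
  move=> nxy; apply: big1 => w _; apply: big1 => j _; apply: big1 => i _.
  by rewrite /S asboolF // (islin0 (@evfam_linr _ _ _ _ _ _ _ _ _)).
(* Three cases: [x] not below [y], where all morphisms vanish; [x] equivalent to [y], where only [L]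
   counts; [x] strictly below [y], where only [M] counts. *)
case: (pselect (preceq x y)) => [xy|nxy]; last first.
  rewrite Lout; last by case.
  rewrite Mout ?addr0; last by case.
  by apply: big1 => i _; rewrite (preceq_hom (bas i) nxy) linear0 scale0r.
case: (pselect (preceq y x)) => [yx|nyx].
  rewrite Mout ?addr0; last by case.
  rewrite /L (bigD1_seq x) //=; last by apply/As.
  rewrite [X in _ + X]big1 ?addr0 => [|x' /eqP nx].
    by apply: eq_bigr => i _; rewrite evfamE.
  by apply: big1 => i _; rewrite evfam_neql.
rewrite Lout ?add0r; last by case.
have Sx w j : push (bas j) (S w j) c =
    \sum_i evfam (comp E (bas j) (G x i w j)) (t x y (dbas i)) c.
  pose S' : Fam E P := fun a z d => \sum_i evfam (G x i w j) (t x y (dbas i)) d.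
  transitivity (push (bas j) S' c).
    by apply: push_ext => d; rewrite /S asboolT.
  by rewrite push_sum; apply: eq_bigr => i _; rewrite push_evfam.
rewrite /M; under [RHS]eq_bigr do under eq_bigr do rewrite Sx.
under [RHS]eq_bigr do rewrite exchange_big.
rewrite exchange_big; apply: eq_bigr => i _ /=.
(* The chosen factorization of [bas i], valid because [x] is strictly below [y]. *)
rewrite -evfamE [X in evfam X](svalP (cid (HG x i)) (conj xy nyx)).
rewrite (islin_sum _ _ (evfam_linl _ _)).
by apply: eq_bigr => w _; rewrite (islin_sum _ _ (evfam_linl _ _)).
Qed.

(** The class of all defects, at all objects and of all linear families, is closed under expansion,
    as [nakayama] requires. *)
Lemma defect_eq0 y t : left_strictly_locally_finite E -> linfam t -> defect y t = 0.
Proof.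
move=> Efin tL.
apply: (@nakayama _ _ _ cQ (fun w q => exists2 t, linfam t & q = defect w t) _ _ y).
- by case: Efin.
- by move=> w q [s sL ->]; apply: defect_expands.
- by exists t.
Qed.

(** The element of [Q] with component [psi a p] at each [a], obtained by inverting the decomposition
    of [Q] into its components. *)
Definition extension p : Q :=
  cpi cQ (fun a b c => evfam (idm E a) (psi a p) c).

Lemma act1_extension y p : actQ (idm E y) (extension p) = psi y p.
Proof.
have L : linfam (fun a b (c : C a b) => evfam (idm E a) (psi a p) c).
  by move=> a b; apply: evfam_lin.
rewrite (act1_cpi_ext cQ L (@evfam_lin _ _ _ _ _ (idm E y) (psi y p))).
  by rewrite -/(actQ (idm E y) (psi y p)) !act1_psi.
move=> x c; case: (pselect (x = y)) => [e|n]; first by subst x.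
by rewrite evfam_neqr // evfam_neql //; apply: nesym.
Qed.

(** An element of the component at [x] has zero component at any other [y], so [psi y] kills it. *)
Lemma extension_Theta_obj x p : Theta_obj cP x p -> extension p = phi x p.
Proof.
move=> px; apply: (act1_inj (cP := cQ)) => y; rewrite act1_extension.
rewrite -(psi_Theta_obj px) -(act1_psi x).
case: (pselect (y = x)) => [->|n]; first by rewrite !act1_psi.
rewrite act1_neq // -(Theta_objE px) -[actP _ _]/(actP (idm E x) p).
by rewrite -(act1_psi y) -psi_act act1_neq // (islin0 (@psi_lin y)).
Qed.

Lemma extension_contra_hom :
  left_strictly_locally_finite E -> contra_hom cP cQ extension.
Proof.
move=> Efin; have gL : islin extension.
  move=> a p p'; apply: (act1_inj (cP := cQ)) => y.
  by rewrite act_linr !act1_extension psi_lin.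
split=> // f fL; apply: (act1_inj (cP := cQ)) => y; rewrite act1_extension.
have /eqP := defect_eq0 y Efin fL; rewrite subr_eq0 => /eqP ->.
(* Under the contraaction each value of [extension] may be replaced by its component, which is given
   by [psi x]. *)
rewrite -[in RHS]cpi_act1; last by move=> x b al c c'; rewrite fL gL.
by congr (actQ _ (cpi cQ _)); apply: fam_ext => x b c; rewrite act1_extension.
Qed.

End Fullness.

Theorem theorem3p7 (k : fieldType) (E : klcat k) :
  left_strictly_locally_finite E -> Theta_fully_faithful E.
Proof.
move=> Efin; split; first exact: Theta_is_faithful.
move=> P Q cP cQ phi phi_hom; exists (extension cP cQ phi).
split; first exact: extension_contra_hom.
exact: extension_Theta_obj.
Qed.
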